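(* For every $n\ge1$, the group $\mathrm U(n,1;\mathbb R\oplus\mathbb R)$ is abstractly isomorphic to $\mathrm{GL}(n+1;\mathbb R)$, and $\mathrm{SU}(n,1;\mathbb R\oplus\mathbb R)\cong\mathrm{SL}(n+1;\mathbb R)$.
   Context: $\mathbb R\oplus\mathbb R$ is regarded as the real algebra $\{a+\lambda b: a,b\in\mathbb R\}$ with $\lambda^2=1$, with conjugation $\overline{a+\lambda b}=a-\lambda b$ (equivalently, the coordinate swap on $\mathbb R\oplus\mathbb R$). For a matrix $A$ over this algebra, $A^\dagger=\overline A^{\,T}$. With $Q=\mathrm{diag}(I_n,-1)$, $$\mathrm U(n,1;\mathbb R\oplus\mathbb R)=\{A\in \mathrm M(n+1;\mathbb R\oplus\mathbb R): A^\dagger QA=Q\},$$ and $\mathrm{SU}(n,1;\mathbb R\oplus\mathbb R)$ is the subgroup of elements of determinant $1$. *)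

(* Defs.v *)
From HB Require Import structures.
From mathcomp Require Import all_boot all_order all_algebra.
From mathcomp Require Import ring.

Set Implicit Arguments.
Unset Strict Implicit.
Unset Printing Implicit Defensive.

Import GRing.Theory.
Local Open Scope ring_scope.

(* SplitC a b stands for a + lambda b, where lambda ^+ 2 = 1; the coordinates
   (a + b, a - b) identify this algebra with R (+) R, and splitc_conj with the
   swap, when 2 is invertible. *)
Record splitc (R : Type) := SplitC { spre : R; spim : R }.

Section SplitAlgebra.
Variable R : comNzRingType.
Implicit Types x y z : splitc R.

Definition splitc_pair x := (spre x, spim x).
Definition pair_splitc (p : R * R) := SplitC p.1 p.2.

Fact splitc_pairK : cancel splitc_pair pair_splitc.
Proof. by case. Qed.

HB.instance Definition _ := Choice.copy (splitc R) (can_type splitc_pairK).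

Definition splitc_zero := SplitC (0 : R) 0.
Definition splitc_opp x := SplitC (- spre x) (- spim x).
Definition splitc_add x y := SplitC (spre x + spre y) (spim x + spim y).

Fact splitc_addA : associative splitc_add.
Proof. by case=> a b [c d] [e f]; rewrite /splitc_add /= !addrA. Qed.

Fact splitc_addC : commutative splitc_add.
Proof.
by case=> a b [c d]; rewrite /splitc_add /= addrC; congr SplitC; rewrite addrC.
Qed.

Fact splitc_add0 : left_id splitc_zero splitc_add.
Proof. by case=> a b; rewrite /splitc_add /= !add0r. Qed.

Fact splitc_addN : left_inverse splitc_zero splitc_opp splitc_add.
Proof. by case=> a b; rewrite /splitc_add /= !addNr. Qed.

HB.instance Definition _ := GRing.isZmodule.Build (splitc R)
  splitc_addA splitc_addC splitc_add0 splitc_addN.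

Definition splitc_one := SplitC (1 : R) 0.
Definition splitc_mul x y :=
  SplitC (spre x * spre y + spim x * spim y)
         (spre x * spim y + spim x * spre y).

Fact splitc_mulA : associative splitc_mul.
Proof.
by case=> a b [c d] [e f]; congr SplitC => /=; ring.
Qed.

Fact splitc_mulC : commutative splitc_mul.
Proof.
by case=> a b [c d]; congr SplitC => /=; ring.
Qed.

Fact splitc_mul1 : left_id splitc_one splitc_mul.
Proof. by case=> a b; congr SplitC => /=; ring. Qed.

Fact splitc_mulDl : left_distributive splitc_mul +%R.
Proof.
by case=> a b [c d] [e f]; congr SplitC => /=; ring.
Qed.

Fact splitc_1_neq0 : splitc_one != 0.
Proof. by apply/eqP => -[/eqP]; rewrite oner_eq0. Qed.

HB.instance Definition _ := GRing.Zmodule_isComNzRing.Build (splitc R)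
  splitc_mulA splitc_mulC splitc_mul1 splitc_mulDl splitc_1_neq0.

Definition splitc_scale (a : R) x := SplitC (a * spre x) (a * spim x).

Fact splitc_scaleA a b x :
  splitc_scale a (splitc_scale b x) = splitc_scale (a * b) x.
Proof. by rewrite /splitc_scale /= !mulrA. Qed.

Fact splitc_scale1 : left_id 1 splitc_scale.
Proof. by case=> a b; rewrite /splitc_scale /= !mul1r. Qed.

Fact splitc_scaleDr : right_distributive splitc_scale +%R.
Proof. by move=> a x y; rewrite /splitc_scale /= !mulrDr. Qed.

Fact splitc_scaleDl x : {morph splitc_scale^~ x : a b / a + b}.
Proof. by move=> a b; rewrite /splitc_scale !mulrDl. Qed.

HB.instance Definition _ := GRing.Zmodule_isLmodule.Build R (splitc R)
  splitc_scaleA splitc_scale1 splitc_scaleDr splitc_scaleDl.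

Fact splitc_scaleAl (a : R) x y : a *: (x * y) = (a *: x) * y.
Proof. by case: x y => [c d] [e f]; congr SplitC => /=; ring. Qed.

HB.instance Definition _ :=
  GRing.Lmodule_isLalgebra.Build R (splitc R) splitc_scaleAl.

Fact splitc_scaleAr (a : R) x y : a *: (x * y) = x * (a *: y).
Proof. by case: x y => [c d] [e f]; congr SplitC => /=; ring. Qed.

HB.instance Definition _ :=
  GRing.Lalgebra_isAlgebra.Build R (splitc R) splitc_scaleAr.

Definition splitc_lambda : splitc R := SplitC 0 1.

Lemma splitc_lambda_sqr : splitc_lambda ^+ 2 = 1.
Proof. by congr SplitC => /=; ring. Qed.

Lemma splitcE x : x = (spre x)%:A + splitc_lambda * (spim x)%:A.
Proof. by case: x => a b; congr SplitC => /=; ring. Qed.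

Definition splitc_conj x : splitc R := SplitC (spre x) (- spim x).

Fact splitc_conj_is_zmod_morphism : zmod_morphism splitc_conj.
Proof. by case=> a b [c d]; congr SplitC => /=; ring. Qed.

Fact splitc_conj_is_monoid_morphism : monoid_morphism splitc_conj.
Proof. by split=> [|[a b] [c d]]; congr SplitC => /=; ring. Qed.

HB.instance Definition _ := GRing.isZmodMorphism.Build (splitc R) (splitc R)
  splitc_conj splitc_conj_is_zmod_morphism.
HB.instance Definition _ := GRing.isMonoidMorphism.Build (splitc R) (splitc R)
  splitc_conj splitc_conj_is_monoid_morphism.

Lemma splitc_conjK : involutive splitc_conj.
Proof. by case=> a b; rewrite /splitc_conj /= opprK. Qed.

Definition dagger m n (A : 'M[splitc R]_(m, n)) : 'M[splitc R]_(n, m) :=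
  (map_mx splitc_conj A)^T.

Lemma daggerM m n p (A : 'M_(m, n)) (B : 'M_(n, p)) :
  dagger (A *m B) = dagger B *m dagger A.
Proof. by rewrite /dagger map_mxM trmx_mul. Qed.

Lemma daggerK m n : cancel (@dagger m n) (@dagger n m).
Proof. by move=> A; apply/matrixP => i j; rewrite !mxE splitc_conjK. Qed.

Definition formQ n : 'M[splitc R]_(n + 1) := block_mx 1%:M 0 0 (- 1)%:M.

Lemma formQ_sqr n : formQ n *m formQ n = 1%:M.
Proof.
rewrite mulmx_block !mulmx0 !mul0mx !addr0 !add0r mul1mx -scalar_mxM mulrNN.
by rewrite mulr1 -scalar_mx_block.
Qed.

Lemma dagger_formQ n : dagger (formQ n) = formQ n.
Proof.
rewrite /dagger map_block_mx tr_block_mx !map_mx0 !trmx0 !map_scalar_mx.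
by rewrite !tr_scalar_mx rmorphN rmorph1.
Qed.

End SplitAlgebra.

(* unitary R n is U(n, 1; R (+) R): the index n is that of the positive block,
   the matrices have size n + 1. *)
Record unitary (R : comNzRingType) (n : nat) := Unitary {
  unitary_mx :> 'M[splitc R]_(n + 1);
  _ : dagger unitary_mx *m formQ R n *m unitary_mx == formQ R n }.

Section UnitaryGroup.
Variables (R : comNzRingType) (n : nat).
Local Notation U := (unitary R n).
Local Notation Q := (formQ R n).

HB.instance Definition _ := [isSub for @unitary_mx R n].
HB.instance Definition _ := [Choice of U by <:].

Lemma unitaryP (A : U) : dagger A *m Q *m A = Q.
Proof. by case: A => A /= /eqP. Qed.

Fact unitary_one_subproof : dagger 1%:M *m Q *m 1%:M == Q.
Proof.
by rewrite mulmx1 /dagger map_scalar_mx rmorph1 tr_scalar_mx mul1mx.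
Qed.
Definition unitary_one : U := Unitary unitary_one_subproof.

Fact unitary_mul_subproof (A B : U) : dagger (A *m B) *m Q *m (A *m B) == Q.
Proof.
by rewrite daggerM !mulmxA -!(mulmxA (dagger B)) mulmxA unitaryP unitaryP.
Qed.
Definition unitary_mul (A B : U) : U := Unitary (unitary_mul_subproof A B).

Lemma unitary_mulVmx (A : U) : Q *m dagger A *m Q *m A = 1%:M.
Proof. by rewrite -!mulmxA [dagger A *m _]mulmxA unitaryP formQ_sqr. Qed.

Lemma unitary_mulmxV (A : U) : A *m (Q *m dagger A *m Q) = 1%:M.
Proof. by apply: mulmx1C; exact: unitary_mulVmx. Qed.

Fact unitary_inv_subproof (A : U) :
  dagger (Q *m dagger A *m Q) *m Q *m (Q *m dagger A *m Q) == Q.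
Proof.
rewrite !daggerM daggerK dagger_formQ -!mulmxA [Q *m (Q *m _)]mulmxA formQ_sqr.
by rewrite mul1mx [Q *m (dagger A *m Q)]mulmxA unitary_mulmxV mulmx1.
Qed.
Definition unitary_inv (A : U) : U := Unitary (unitary_inv_subproof A).

Fact unitary_mulA : associative unitary_mul.
Proof. by move=> A B C; apply: val_inj; rewrite /= mulmxA. Qed.
Fact unitary_mul1 : left_id unitary_one unitary_mul.
Proof. by move=> A; apply: val_inj; rewrite /= mul1mx. Qed.
Fact unitary_mulr1 : right_id unitary_one unitary_mul.
Proof. by move=> A; apply: val_inj; rewrite /= mulmx1. Qed.
Fact unitary_mulV : left_inverse unitary_one unitary_inv unitary_mul.
Proof. by move=> A; apply: val_inj; rewrite /= unitary_mulVmx. Qed.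
Fact unitary_mulrV : right_inverse unitary_one unitary_inv unitary_mul.
Proof. by move=> A; apply: val_inj; rewrite /= unitary_mulmxV. Qed.

HB.instance Definition _ := isGroup.Build U
  unitary_mulA unitary_mul1 unitary_mulr1 unitary_mulV unitary_mulrV.

Definition unitary_det1 : pred U := fun A => \det A == 1.

Fact unitary_det1_closed : group_closed unitary_det1.
Proof.
split=> [|A B]; first by rewrite /unitary_det1 unfold_in /= det1.
rewrite !unfold_in /unitary_det1 => /eqP dA /eqP dB /=.
have := congr1 determinant (unitary_mulmxV B).
by rewrite !det_mulmx dA dB det1 !mul1r => ->.
Qed.

End UnitaryGroup.

Record special_unitary (R : comNzRingType) (n : nat) := SpecialUnitary {
  special_unitary_val :> unitary R n;
  _ : unitary_det1 special_unitary_val }.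

HB.instance Definition _ (R : comNzRingType) (n : nat) :=
  [isSub for @special_unitary_val R n].
HB.instance Definition _ (R : comNzRingType) (n : nat) :=
  [Choice of special_unitary R n by <:].
HB.instance Definition _ (R : comNzRingType) (n : nat) :=
  SubChoice_isSubGroup.Build (unitary R n) (@unitary_det1 R n)
    (special_unitary R n) (@unitary_det1_closed R n).

Record general_linear (R : comUnitRingType) (m : nat) := GeneralLinear {
  general_linear_mx :> 'M[R]_m;
  _ : general_linear_mx \in unitmx }.

Section GeneralLinearGroup.
Variables (R : comUnitRingType) (m : nat).
Local Notation GL := (general_linear R m).

HB.instance Definition _ := [isSub for @general_linear_mx R m].
HB.instance Definition _ := [Choice of GL by <:].

Lemma general_linearP (A : GL) : (A : 'M_m) \in unitmx.
Proof. by case: A. Qed.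

Definition general_linear_one : GL := GeneralLinear (unitmx1 R m).

Fact general_linear_mul_subproof (A B : GL) : A *m B \in unitmx.
Proof. by rewrite unitmx_mul !general_linearP. Qed.
Definition general_linear_mul (A B : GL) : GL :=
  GeneralLinear (general_linear_mul_subproof A B).

Fact general_linear_inv_subproof (A : GL) : invmx A \in unitmx.
Proof. by rewrite unitmx_inv general_linearP. Qed.
Definition general_linear_inv (A : GL) : GL :=
  GeneralLinear (general_linear_inv_subproof A).

Fact general_linear_mulA : associative general_linear_mul.
Proof. by move=> A B C; apply: val_inj; rewrite /= mulmxA. Qed.
Fact general_linear_mul1 : left_id general_linear_one general_linear_mul.
Proof. by move=> A; apply: val_inj; rewrite /= mul1mx. Qed.
Fact general_linear_mulr1 : right_id general_linear_one general_linear_mul.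
Proof. by move=> A; apply: val_inj; rewrite /= mulmx1. Qed.
Fact general_linear_mulV :
  left_inverse general_linear_one general_linear_inv general_linear_mul.
Proof.
by move=> A; apply: val_inj; rewrite /= mulVmx ?general_linearP.
Qed.
Fact general_linear_mulrV :
  right_inverse general_linear_one general_linear_inv general_linear_mul.
Proof.
by move=> A; apply: val_inj; rewrite /= mulmxV ?general_linearP.
Qed.

HB.instance Definition _ := isGroup.Build GL
  general_linear_mulA general_linear_mul1 general_linear_mulr1
  general_linear_mulV general_linear_mulrV.

Definition general_linear_det1 : pred GL := fun A => \det A == 1.

Fact general_linear_det1_closed : group_closed general_linear_det1.
Proof.
split=> [|A B]; first by rewrite /general_linear_det1 unfold_in /= det1.
rewrite !unfold_in /general_linear_det1 => /eqP dA /eqP dB /=.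
by rewrite det_mulmx det_inv dA dB mul1r invr1.
Qed.

End GeneralLinearGroup.

Record special_linear (R : comUnitRingType) (m : nat) := SpecialLinear {
  special_linear_val :> general_linear R m;
  _ : general_linear_det1 special_linear_val }.

HB.instance Definition _ (R : comUnitRingType) (m : nat) :=
  [isSub for @special_linear_val R m].
HB.instance Definition _ (R : comUnitRingType) (m : nat) :=
  [Choice of special_linear R m by <:].
HB.instance Definition _ (R : comUnitRingType) (m : nat) :=
  SubChoice_isSubGroup.Build (general_linear R m) (@general_linear_det1 R m)
    (special_linear R m) (@general_linear_det1_closed R m).

(* A multiplicative map between groups preserves 1 and inverses. *)
Definition group_isomorphic (G H : groupType) : Prop :=
  exists f : {multiplicative G -> H}, bijective f.

(* Main.v *)
Require Import Defs.
From mathcomp Require Import all_boot all_order all_algebra.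
From mathcomp Require Import reals.
From HB Require Import structures.
From mathcomp Require Import ring.

(** The two ring morphisms a + lambda b |-> a + b and a + lambda b |-> a - b
    identify the split algebra with R (+) R as soon as 2 is invertible, and
    conjugation exchanges them.  A matrix A over the split algebra is therefore
    a pair (P, N) of matrices over R, and its dagger is the pair (N^T, P^T).
    Writing q for the matrix diag(I_n, -1) over R, the equation
    A^dagger Q A = Q becomes the two equations N^T q P = q and P^T q N = q.
    They are transposes of each other because q is symmetric, and since
    q q = 1 the first one says exactly that P is invertible with
    N^T = q P^-1 q.  Thus P is an arbitrary invertible matrix and it determines
    N, so A |-> P is an isomorphism onto the general linear group
    (unitary_to_glK and gl_to_unitaryK).

    The determinant d of A satisfies conj(d) d = 1, because det(Q)^2 = 1; so its
    two coordinates are inverse to each other, and d = 1 if and only if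
    det P = 1 (unitary_to_gl_det1).  Hence the isomorphism restricts to the
    subgroups of determinant 1.

    The second coordinate is written throughout as the first coordinate of the
    conjugate, respectively of the dagger. *)

Set Implicit Arguments.
Unset Strict Implicit.
Unset Printing Implicit Defensive.

Import GRing.Theory Num.Theory.
Local Open Scope ring_scope.

Section FirstCoordinate.
Variable R : comNzRingType.

Definition splitc_plus (x : splitc R) : R := spre x + spim x.

Fact splitc_plus_is_zmod_morphism : zmod_morphism splitc_plus.
Proof. by case=> a b [c d]; rewrite /splitc_plus /=; ring. Qed.

Fact splitc_plus_is_monoid_morphism : monoid_morphism splitc_plus.
Proof. by split=> [|[a b] [c d]]; rewrite /splitc_plus /=; ring. Qed.

HB.instance Definition _ := GRing.isZmodMorphism.Build (splitc R) R
  splitc_plus splitc_plus_is_zmod_morphism.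
HB.instance Definition _ := GRing.isMonoidMorphism.Build (splitc R) R
  splitc_plus splitc_plus_is_monoid_morphism.

Definition plus_mx m n (A : 'M[splitc R]_(m, n)) : 'M[R]_(m, n) :=
  map_mx splitc_plus A.

Lemma plus_mxM m n p (A : 'M_(m, n)) (B : 'M_(n, p)) :
  plus_mx (A *m B) = plus_mx A *m plus_mx B.
Proof. exact: map_mxM. Qed.

Definition plusQ n : 'M[R]_(n + 1) := plus_mx (formQ R n).

Lemma plusQ_sqr n : plusQ n *m plusQ n = 1%:M.
Proof. by rewrite -plus_mxM formQ_sqr /plus_mx map_mx1. Qed.

Lemma det_dagger n (A : 'M[splitc R]_n) :
  \det (dagger A) = splitc_conj (\det A).
Proof. by rewrite /dagger det_tr det_map_mx. Qed.

Lemma unitary_det n (A : unitary R n) : splitc_conj (\det A) * \det A = 1.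
Proof.
have dQ : \det (formQ R n) * \det (formQ R n) = 1.
  by rewrite -det_mulmx formQ_sqr det1.
have := congr1 determinant (unitary_mulVmx A).
rewrite !det_mulmx det_dagger det1 => <-.
by rewrite (mulrC (\det (formQ R n))) -(mulrA (splitc_conj _)) dQ mulr1.
Qed.

End FirstCoordinate.

Arguments plusQ {R} n.

Section UnitaryGeneralLinear.
Variable R : comUnitRingType.

Lemma plus_mx_unitary n (A : unitary R n) :
  plus_mx (dagger A) *m plusQ n *m plus_mx A = plusQ n.
Proof. by rewrite -!plus_mxM unitaryP. Qed.

Fact unitary_to_gl_subproof n (A : unitary R n) : plus_mx A \in unitmx.
Proof.
have := congr1 (@plus_mx R _ _) (unitary_mulVmx A).
by rewrite plus_mxM /plus_mx map_mx1 => /mulmx1_unit[].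
Qed.

Definition unitary_to_gl n (A : unitary R n) : general_linear R (n + 1) :=
  GeneralLinear (unitary_to_gl_subproof A).

Fact unitary_to_glM n : {morph @unitary_to_gl n : A B / (A * B)%g}.
Proof. by move=> A B; apply: val_inj; rewrite /= plus_mxM. Qed.

HB.instance Definition _ n := isMultiplicative.Build
  (unitary R n) (general_linear R (n + 1)) (@unitary_to_gl n)
  (@unitary_to_glM n).

(** The equation N^T q P = q solved for N^T, using q q = 1. *)
Lemma plus_mx_dagger_unitary n (A : unitary R n) :
  plus_mx (dagger A) = plusQ n *m invmx (plus_mx A) *m plusQ n.
Proof.
rewrite -[X in _ = X *m _ *m _](plus_mx_unitary A) mulmxK ?unitary_to_gl_subproof //.
by rewrite -mulmxA plusQ_sqr mulmx1.
Qed.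

Hypothesis unit2 : (2 : R) \is a GRing.unit.

Lemma splitc_plus_inj (x y : splitc R) :
    splitc_plus x = splitc_plus y ->
    splitc_plus (splitc_conj x) = splitc_plus (splitc_conj y) ->
  x = y.
Proof.
case: x y => [a b] [c d]; rewrite /splitc_plus /= => eq1 eq2.
congr SplitC; apply: (mulrI unit2).
  have -> : 2 * a = (a + b) + (a - b) by ring.
  by rewrite eq1 eq2; ring.
have -> : 2 * b = (a + b) - (a - b) by ring.
by rewrite eq1 eq2; ring.
Qed.

Lemma plus_mx_inj m n (A B : 'M[splitc R]_(m, n)) :
    plus_mx A = plus_mx B -> plus_mx (dagger A) = plus_mx (dagger B) ->
  A = B.
Proof.
move=> /matrixP eqAB /matrixP eqAB'; apply/matrixP=> i j.
by apply: splitc_plus_inj; [have := eqAB i j | have := eqAB' j i]; rewrite !mxE.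
Qed.

Definition splitc_glue (u v : R) : splitc R :=
  SplitC ((u + v) / 2) ((u - v) / 2).

Lemma splitc_plus_glue u v : splitc_plus (splitc_glue u v) = u.
Proof.
rewrite /splitc_plus /= -mulrDl; apply: (mulIr unit2).
by rewrite mulrVK //; ring.
Qed.

Lemma splitc_conj_glue u v : splitc_conj (splitc_glue u v) = splitc_glue v u.
Proof. by rewrite /splitc_conj /splitc_glue /= -mulNr opprB [v + u]addrC. Qed.

(** The matrix with first coordinate P whose dagger has first coordinate M. *)
Definition glue_mx m n (P : 'M[R]_(m, n)) (M : 'M[R]_(n, m)) :
  'M[splitc R]_(m, n) := \matrix_(i, j) splitc_glue (P i j) (M j i).

Lemma plus_mx_glue m n (P : 'M_(m, n)) (M : 'M_(n, m)) :
  plus_mx (glue_mx P M) = P.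
Proof. by apply/matrixP=> i j; rewrite !mxE splitc_plus_glue. Qed.

Lemma dagger_glue m n (P : 'M_(m, n)) (M : 'M_(n, m)) :
  dagger (glue_mx P M) = glue_mx M P.
Proof. by apply/matrixP=> i j; rewrite !mxE splitc_conj_glue. Qed.

(** Both sides of the unitary equation are fixed by the dagger, so it can be
    checked on first coordinates only. *)
Lemma unitary_of_plus n (A : 'M[splitc R]_(n + 1)) :
    plus_mx (dagger A) *m plusQ n *m plus_mx A = plusQ n ->
  dagger A *m formQ R n *m A == formQ R n.
Proof.
rewrite -!plus_mxM => plusE; apply/eqP; apply: plus_mx_inj => //.
by rewrite !daggerM daggerK dagger_formQ mulmxA.
Qed.

Fact gl_to_unitary_subproof n (P : general_linear R (n + 1)) :
  let A := glue_mx P (plusQ n *m invmx P *m plusQ n) in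
  dagger A *m formQ R n *m A == formQ R n.
Proof.
apply: unitary_of_plus; rewrite dagger_glue !plus_mx_glue.
rewrite -(mulmxA _ (plusQ n) (plusQ n)) plusQ_sqr mulmx1.
by rewrite mulmxKV ?general_linearP.
Qed.

Definition gl_to_unitary n (P : general_linear R (n + 1)) : unitary R n :=
  Unitary (gl_to_unitary_subproof P).

Lemma gl_to_unitaryK n : cancel (@gl_to_unitary n) (@unitary_to_gl n).
Proof. by move=> P; apply: val_inj; rewrite /= plus_mx_glue. Qed.

Lemma unitary_to_glK n : cancel (@unitary_to_gl n) (@gl_to_unitary n).
Proof.
move=> A; apply: val_inj; apply: plus_mx_inj => /=.
  by rewrite plus_mx_glue.
by rewrite dagger_glue plus_mx_glue plus_mx_dagger_unitary.
Qed.

(** The coordinates of the determinant are mutually inverse, so the first one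
    is 1 only if both are. *)
Lemma unitary_to_gl_det1 n (A : unitary R n) :
  general_linear_det1 (unitary_to_gl A) = unitary_det1 A.
Proof.
rewrite /general_linear_det1 /unitary_det1 /= /plus_mx det_map_mx.
apply/eqP/eqP => [plus_det1|->]; last exact: rmorph1.
apply: splitc_plus_inj; rewrite !rmorph1 //.
have := congr1 (@splitc_plus R) (unitary_det A).
by rewrite rmorphM rmorph1 /= plus_det1 mulr1.
Qed.

Fact su_to_sl_subproof n (A : special_unitary R n) :
  general_linear_det1 (unitary_to_gl A).
Proof. by rewrite unitary_to_gl_det1; case: A. Qed.

Definition su_to_sl n (A : special_unitary R n) : special_linear R (n + 1) :=
  SpecialLinear (su_to_sl_subproof A).

Fact su_to_slM n : {morph @su_to_sl n : A B / (A * B)%g}.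
Proof. by move=> A B; do 2 apply: val_inj; exact: plus_mxM. Qed.

HB.instance Definition _ n := isMultiplicative.Build
  (special_unitary R n) (special_linear R (n + 1)) (@su_to_sl n)
  (@su_to_slM n).

Fact sl_to_su_subproof n (P : special_linear R (n + 1)) :
  unitary_det1 (gl_to_unitary P).
Proof. by rewrite -unitary_to_gl_det1 gl_to_unitaryK; case: P. Qed.

Definition sl_to_su n (P : special_linear R (n + 1)) : special_unitary R n :=
  SpecialUnitary (sl_to_su_subproof P).

Lemma unitary_gl_isomorphic n :
  group_isomorphic (unitary R n) (general_linear R (n + 1)).
Proof.
exists (@unitary_to_gl n).
exact: Bijective (@unitary_to_glK n) (@gl_to_unitaryK n).
Qed.

Lemma special_unitary_sl_isomorphic n :
  group_isomorphic (special_unitary R n) (special_linear R (n + 1)).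
Proof.
exists (@su_to_sl n); exists (@sl_to_su n) => A; do 2 apply: val_inj => /=.
  by rewrite -[glue_mx _ _]/(val (gl_to_unitary (unitary_to_gl A)))
             unitary_to_glK.
by rewrite plus_mx_glue.
Qed.

End UnitaryGeneralLinear.

Theorem mainTheorem10 (R : realType) (n : nat) (n_ge1 : (1 <= n)%N) :
  group_isomorphic (unitary R n) (general_linear R (n + 1)) /\
  group_isomorphic (special_unitary R n) (special_linear R (n + 1)).
Proof.
have unit2 : (2 : R) \is a GRing.unit by rewrite unitfE pnatr_eq0.
by split; [apply: unitary_gl_isomorphic | apply: special_unitary_sl_isomorphic].
Qed.
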